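(* Let $n,r\ge1$. If $\mathcal{F}\subseteq 2(n,r)$ is $3$-sum intersecting, then $|\Delta(\mathcal{F})|\ge|\mathcal{F}|$.
   Context: $2(n,r)$ denotes the set of vectors in $\{0,1,2\}^n$ whose entries sum to $r$. A family is $3$-sum intersecting if for any two distinct members $\mathbf{x},\mathbf{y}$ there is a coordinate $i$ with $x_i+y_i\ge3$. For vectors, $\mathbf{y}<\mathbf{x}$ means $y_i\le x_i$ for all $i$ with strict inequality for some $i$; the shadow is $\Delta(\mathcal{F})=\{\mathbf{y}: \mathbf{y}<\mathbf{x}\text{ for some }\mathbf{x}\in\mathcal{F},\ \sum_i y_i=r-1\}$. *)

(* Defs.v *)
From mathcomp Require Import all_boot.

Set Implicit Arguments.
Unset Strict Implicit.
Unset Printing Implicit Defensive.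

(* Vectors in {0,1,2}^n; entries coerce to nat through 'I_3. *)
Definition vec3 (n : nat) := {ffun 'I_n -> 'I_3}.

Definition vsum n (x : vec3 n) : nat := \sum_(i < n) x i.

(* 2(n, r) *)
Definition layer (n r : nat) : {set vec3 n} := [set x : vec3 n | vsum x == r].

(* The entry sums are taken in nat, not modulo 3. *)
Definition sum_intersecting3 n (F : {set vec3 n}) : Prop :=
  forall x y : vec3 n, x \in F -> y \in F -> x <> y ->
    exists i : 'I_n, 3 <= nat_of_ord (x i) + nat_of_ord (y i).

Definition vlt n (y x : vec3 n) : bool :=
  [forall i, nat_of_ord (y i) <= nat_of_ord (x i)]
  && [exists i, nat_of_ord (y i) < nat_of_ord (x i)].

(* Meant for r >= 1 and F included in layer n r, so that r.-1 is r - 1. *)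
Definition shadow n (r : nat) (F : {set vec3 n}) : {set vec3 n} :=
  [set y : vec3 n | [exists x in F, vlt y x] && (vsum y == r.-1)].

(* Main.v *)
Require Import Defs.
From mathcomp Require Import all_boot.
From mathcomp Require Import all_order all_algebra.

Set Implicit Arguments.
Unset Strict Implicit.
Unset Printing Implicit Defensive.

Import GRing.Theory Num.Theory.

(** The functions phi_z(x) = prod_i 'C(x_i, z_i), |z| = r - 1, restricted to F,
    are nonzero only for z in the shadow of F, so it suffices that the matrix
    (phi_z(x))_(x in F, z) has independent rows. Let c be a linear relation
    between the rows. On the layer r one has
      (r - |z|) phi_z = sum_i (z_i + 1) phi_(z + e_i),
    so c annihilates phi_z for every |z| < r. For y in F put
      P_y(x) = prod_i h_(y_i)(x_i),
      h_0 = 1, h_1(t) = 2 - t, h_2(t) = (1 - t)(2 - t).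
    P_y has degree r with top term a nonzero multiple of phi_y, which is the
    indicator of y on the layer; and P_y(x) = 0 exactly when x_i + y_i >= 3 for
    some i. If y has an entry 2, then P_y vanishes on all of F, y included, and
    hence c_y = 0. Two vectors without an entry 2 do not intersect, so at most
    one coefficient c_y remains, and it vanishes because y has a shadow. *)

(** The index [z] takes values in [nat], not in ['I_3]: z + e_i may have an entry 3, and then the
    product is 0. *)
Definition binprod n (z : 'I_n -> nat) (x : vec3 n) : nat :=
  \prod_(i < n) 'C(x i, z i).

Definition incr_at n (z : 'I_n -> nat) (i : 'I_n) : 'I_n -> nat :=
  fun j => z j + (j == i).

Lemma eq_binprod n (z1 z2 : 'I_n -> nat) (x : vec3 n) :
  z1 =1 z2 -> binprod z1 x = binprod z2 x.
Proof. by move=> e; apply: eq_bigr => i _; rewrite e. Qed.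

Lemma binprod_gt0 n (z : 'I_n -> nat) (x : vec3 n) :
  (0 < binprod z x) = [forall i, z i <= x i].
Proof.
apply/idP/forallP => [h i | h]; last by apply: prodn_gt0 => i; rewrite bin_gt0.
by move: h; rewrite /binprod (bigD1 i) //= muln_gt0 bin_gt0 => /andP[].
Qed.

Lemma vsum_leqif n (z x : vec3 n) :
  (forall i, z i <= x i) -> vsum z <= vsum x ?= iff (z == x).
Proof.
move=> le_zx.
have -> : (z == x) = [forall (i | true), (z i : nat) == x i].
  apply/eqP/forallP => [-> i | h]; first by rewrite eqxx.
  by apply/ffunP => i; apply/val_inj/eqP/(implyP (h i)).
by apply: leqif_sum => i _; apply/leqif_eq.
Qed.

Lemma binprod_layer n (z x : vec3 n) :
  vsum z = vsum x -> binprod (fun i => z i) x = (z == x).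
Proof.
move=> eq_s; case: eqP => [<- | /eqP ne_zx].
  by rewrite /binprod big1 // => i _; rewrite binn.
apply/eqP; rewrite eqn0Ngt binprod_gt0; apply: contra ne_zx => /forallP.
by move=> /vsum_leqif <-; rewrite eq_s.
Qed.

Lemma sum_incr_at n (z : 'I_n -> nat) i :
  \sum_j incr_at z i j = (\sum_j z j).+1.
Proof.
rewrite /incr_at big_split /= -addn1; congr addn.
by rewrite (bigD1 i) //= eqxx big1 // => j /negPf->.
Qed.

(** This is (a + 1) C(t, a + 1) = (t - a) C(t, a) in coordinate i. Truncated subtraction is
    harmless: both binomials vanish for t < a. *)
Lemma binprod_incr_at n (z : 'I_n -> nat) i (x : vec3 n) :
  (z i).+1 * binprod (incr_at z i) x = (x i - z i) * binprod z x.
Proof.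
rewrite /binprod (bigD1 i) //= [in RHS](bigD1 i) //= !mulnA.
rewrite /incr_at eqxx addn1 mul_bin_left; congr muln.
by apply: eq_bigr => j /negPf->; rewrite addn0.
Qed.

Lemma sum_binprod_incr_at n (z : 'I_n -> nat) (x : vec3 n) :
  \sum_i (z i).+1 * binprod (incr_at z i) x
    = (vsum x - \sum_i z i) * binprod z x.
Proof.
under eq_bigr do rewrite binprod_incr_at.
(* Truncated differences add up as wanted when z <= x; otherwise [binprod z x] is 0. *)
rewrite -big_distrl /=; case: (posnP (binprod z x)) => [-> | ].
  by rewrite !muln0.
by rewrite binprod_gt0 => /forallP le_zx; rewrite sumnB.
Qed.

Local Open Scope ring_scope.

(* Coefficient of 'C(t, j) in h_a(t). *)
Definition hcoef (a j : nat) : rat :=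
  nth 0 (nth [::] [:: [:: 1]; [:: 2; -1]; [:: 2; -2; 2]] a) j.

Lemma hcoef_eq0 (a j : nat) : (a < j)%N -> hcoef a j = 0.
Proof.
by case: a j => [|[|[|a]]] [|[|[|[|j]]]] // _; rewrite /hcoef /= ?nth_nil.
Qed.

Lemma hcoef_diag_neq0 (a : 'I_3) : hcoef a a != 0.
Proof. by case: a => [[|[|[|a]]] ?]. Qed.

Lemma sum_hcoef_bin (a b : 'I_3) : (3 <= a + b)%N ->
  \sum_(j < 3) hcoef a j * 'C(b, j)%:R = 0.
Proof.
rewrite !big_ord_recl big_ord0.
by case: a b => [[|[|[|a]]] ?] [[|[|[|b]]] ?].
Qed.

Section Relation.

Variables (n r m : nat) (x : 'I_m -> vec3 n) (c : 'I_m -> rat).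
Hypothesis x_layer : forall k, vsum (x k) = r.
Hypothesis c_rel : forall z : 'I_n -> nat, (\sum_i z i)%N = r.-1 ->
  \sum_k c k * (binprod z (x k))%:R = 0.

Lemma relation_lower (z : 'I_n -> nat) : (\sum_i z i < r)%N ->
  \sum_k c k * (binprod z (x k))%:R = 0.
Proof.
(* Descending induction on |z|: the nonzero factor r - |z| can be cancelled. *)
move e: (r.-1 - \sum_i z i)%N => d.
elim: d z e => [|d IHd] z e lt_zr.
  apply: c_rel; apply/eqP; rewrite eqn_leq -[X in _ && X]subn_eq0 e eqxx andbT.
  by rewrite -ltnS prednK // (leq_ltn_trans _ lt_zr).
have nz : (r - \sum_i z i)%:R != 0 :> rat by rewrite pnatr_eq0 subn_eq0 -ltnNge.
apply: (mulfI nz); rewrite mulr0 mulr_sumr.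
transitivity (\sum_k \sum_i
    (z i).+1%:R * (c k * (binprod (incr_at z i) (x k))%:R)).
  apply: eq_bigr => k _; rewrite mulrCA -natrM -(x_layer k) -sum_binprod_incr_at.
  by rewrite natr_sum mulr_sumr; apply: eq_bigr => i _; rewrite natrM mulrCA.
rewrite exchange_big big1 //= => i _.
rewrite -mulr_sumr IHd ?mulr0 // sum_incr_at.
  by rewrite subnS e.
by rewrite -subn_gt0 subnS -subn1 -subnDA addnC subnDA subn1 e.
Qed.

Lemma relation_coef_eq0 k i0 : injective x ->
    (forall k', k' != k -> exists i, 3 <= x k i + x k' i)%N ->
  nat_of_ord (x k i0) = 2 -> c k = 0.
Proof.
move=> x_inj x_int xki0; set y := x k.
pose A (z : vec3 n) := \prod_i hcoef (y i) (z i).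
have Py0 k' : \prod_i \sum_(j < 3) hcoef (y i) j * 'C(x k' i, j)%:R = 0.
  have [i le3] : exists i, (3 <= y i + x k' i)%N.
    (* For k' = k the entry 2 of y meets itself: 2 + 2 >= 3. *)
    by case: (eqVneq k' k) => [-> | /x_int //]; exists i0; rewrite xki0.
  by rewrite (bigD1 i) //= sum_hcoef_bin ?mul0r.
have PyE k' : \sum_(z : vec3 n) A z * (binprod (fun i => z i) (x k'))%:R = 0.
  (* Expand the product of sums: choosing one j per coordinate amounts to choosing a vector z. *)
  rewrite -[RHS](Py0 k') bigA_distr_bigA; apply: eq_bigr => z _.
  by rewrite /binprod natr_prod -big_split.
have : \sum_(z : vec3 n)
    A z * \sum_k' c k' * (binprod (fun i => z i) (x k'))%:R = 0.
  under eq_bigr do rewrite mulr_sumr.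
  rewrite exchange_big big1 //= => k' _.
  under eq_bigr do rewrite mulrCA.
  by rewrite -mulr_sumr PyE mulr0.
rewrite (bigD1 y) //= [X in _ + X]big1 ?addr0; last first.
  move=> z ne_zy.
  (* If z < y, its weight is below r and the relation kills it; any other z exceeds y somewhere and
     has coefficient 0. *)
  case: (boolP [forall i, (z i <= y i)%N]) => [/forallP le_zy | ].
    rewrite relation_lower ?mulr0 // -(x_layer k).
    by rewrite (ltn_leqif (vsum_leqif le_zy)).
  rewrite negb_forall => /existsP[i]; rewrite -ltnNge => lt_yz.
  by rewrite /A (bigD1 i) //= hcoef_eq0 // !mul0r.
rewrite (bigD1 k) //= [X in _ + X]big1 ?addr0; last first.
  move=> k' ne_k; rewrite binprod_layer ?x_layer // (inj_eq x_inj) eq_sym.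
  by rewrite (negPf ne_k) mulr0.
have nzA : A y != 0 by apply/prodf_neq0 => i _; apply: hcoef_diag_neq0.
rewrite binprod_layer // eqxx mulr1 => /eqP.
by rewrite mulf_eq0 (negPf nzA) => /eqP.
Qed.

Lemma relation_trivial : (0 < r)%N -> injective x ->
    (forall k k', k' != k -> exists i, 3 <= x k i + x k' i)%N ->
  forall k, c k = 0.
Proof.
move=> r_gt0 x_inj x_int k.
case: (boolP [exists i, nat_of_ord (x k i) == 2]) => [/existsP[i /eqP] | ].
  exact: relation_coef_eq0 (x_int k).
rewrite negb_exists => /forallP xk_ne2.
have c_other k' : k' != k -> c k' = 0.
  move=> ne_k; have [i le3] := x_int k k' ne_k.
  (* At i the entry of [x k] is at most 1, so that of [x k'] must be 2. *)
  apply: (@relation_coef_eq0 k' i) => // [k'' /x_int //|].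
  move: le3 (xk_ne2 i).
  by case: (x k i) (x k' i) => [[|[|[|a]]] ?] [[|[|[|b]]] ?].
have [i xki] : exists i, (0 < x k i)%N.
  apply/existsP; rewrite -[[exists i, _]]negbK negb_exists.
  apply/negP => /forallP h.
  move: r_gt0; rewrite -(x_layer k) /vsum big1 // => i _.
  by apply/eqP; rewrite eqn0Ngt.
(* The vector x_k - e_i has weight r - 1, and its function is positive at x_k. *)
pose z j := (x k j - (j == i))%N.
have sz : (\sum_j z j)%N = r.-1.
  rewrite sumnB => [|j _]; last by case: eqP => // ->.
  rewrite -(x_layer k) -subn1; congr subn.
  by rewrite (bigD1 i) //= eqxx big1 // => j /negPf->.
have := c_rel sz; rewrite (bigD1 k) //= big1 ?addr0; last first.
  by move=> k' /c_other->; rewrite mul0r.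
move=> /eqP; rewrite mulf_eq0 pnatr_eq0 eqn0Ngt binprod_gt0 => /orP[/eqP //|].
by case/negP; apply/forallP => j; apply: leq_subr.
Qed.

End Relation.

(** Needed to obtain [c_rel] for every z of weight r - 1: either z is a column indexed by the
    shadow, or its function vanishes on F. *)
Lemma binprod_shadow n r (F : {set vec3 n}) (z : 'I_n -> nat) (y : vec3 n) :
    F \subset layer n r -> y \in F -> (0 < r)%N -> (\sum_i z i)%N = r.-1 ->
  (0 < binprod z y)%N -> exists2 w, w \in shadow r F & z =1 (fun i => w i).
Proof.
move=> /subsetP sF yF r_gt0 sz; rewrite binprod_gt0 => /forallP le_zy.
(* Since z i <= y i < 3, [inord] never takes its default value. *)
have zw i : z i = ([ffun i => inord (z i)] : vec3 n) i.
  by rewrite ffunE inordK // (leq_ltn_trans (le_zy i)).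
set w := finfun _ in zw.
have sw : vsum w = r.-1 by rewrite -sz; apply: eq_bigr => i _; rewrite -zw.
exists w => //; rewrite inE sw eqxx andbT; apply/existsP; exists y.
rewrite yF /=; apply/andP; split; first by apply/forallP => i; rewrite -zw.
(* Without a strict coordinate, |y| <= |w| = r - 1 would contradict |y| = r. *)
rewrite -[[exists i, _]]negbK negb_exists; apply/negP => /forallP h.
have := sF y yF; rewrite inE => /eqP sy.
suff : (vsum y <= vsum w)%N by rewrite sw sy -ltnS prednK // ltnn.
by apply: leq_sum => i _; rewrite leqNgt.
Qed.

Local Close Scope ring_scope.

Theorem theorem4p2 (n r : nat) (hn : 1 <= n) (hr : 1 <= r)
    (F : {set vec3 n}) (hF : F \subset layer n r)
    (hI : sum_intersecting3 F) :
  #|F| <= #|shadow r F|.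
Proof.
pose x (k : 'I_#|F|) : vec3 n := enum_val k.
pose w (l : 'I_#|shadow r F|) : vec3 n := enum_val l.
pose M : 'M[rat]_(#|F|, #|shadow r F|) :=
  (\matrix_(k, l) (binprod (fun i => w l i) (x k))%:R)%R.
have xF k : x k \in F by apply: enum_valP.
have x_inj : injective x by apply: enum_val_inj.
suff : row_free M by move=> /eqP <-; apply: rank_leq_col.
apply: inj_row_free => v /rowP vM0; apply/rowP => k; rewrite mxE.
apply: (@relation_trivial n r _ x (v 0%R)) => // [k' | z sz | k1 k2 ne_k].
- by have := subsetP hF _ (xF k'); rewrite inE => /eqP.
- case: (boolP [exists k', 0 < binprod z (x k')]) => [/existsP[k' gt0] | ].
    have [w' w'S ew] := binprod_shadow hF (xF k') hr sz gt0.
    have := vM0 (enum_rank_in w'S w'); rewrite !mxE => {2}<-.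
    apply: eq_bigr => k1 _; rewrite mxE /w enum_rankK_in //.
    by rewrite (eq_binprod _ ew).
  rewrite negb_exists => /forallP h; apply: big1 => k' _.
  by have := h k'; rewrite -eqn0Ngt => /eqP->; rewrite mulr0.
- by apply: hI => // /x_inj e; rewrite e eqxx in ne_k.
Qed.
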